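(* Let $d\in\mathbb N^*$, $r\in\mathbb N$, $t\in\mathbb N^*$ and $\boldsymbol\pi=(\pi_1,\dots,\pi_d)\in(M^{\mathcal B,1})^d$. The class of functions $\overline\Gamma^A_{(\boldsymbol\pi,t,r)}$ is VC-subgraph on $[0,1]^d$ with dimension $$V^A_{(\boldsymbol\pi,t,r)}\le2+\left[t(r+1)+2\sum_{j=1}^d|\pi_j|(r+1)\right]\log_2\left[4eU\log_2(2eU)\right],$$ where $U=t+r+2$.
   Context: $M^{\mathcal B,1}$ is the set of all dyadic partitions of $[0,1]$ into the $2^s$ intervals $[0,2^{-s}]$, $(k2^{-s},(k+1)2^{-s}]$ ($1\le k\le2^s-1$), $s\in\mathbb N$; $|\pi|$ is the number of intervals of the partition $\pi$. For $\pi\in M^{\mathcal B,1}$, $\overline S^{\mathcal B,1}_{(\pi,r)}$ is the space of functions on $[0,1]$ that are polynomials of degree at most $r$ on each interval of $\pi$. $\overline S^{\mathcal H,1}_{(t,r)}$ is the space of functions on $[0,1]$ that are polynomials of degree at most $r$ on each of the $t$ intervals $[0,1/t]$, $(h/t,(h+1)/t]$ ($1\le h\le t-1$). Fix real numbers $v_-<v_+$ and let $\overline\Gamma^{\mathcal H,1}_{(t,r)}=\{(\gamma\vee v_-)\wedge v_+:\gamma\in\overline S^{\mathcal H,1}_{(t,r)}\}$. $\overline\Gamma^A_{(\boldsymbol\pi,t,r)}$ is the class of all functions on $[0,1]^d$ of the form $\gamma(\mathbf w)=f[(g(\mathbf w)\vee0)\wedge1]$, $\mathbf w=(w_1,\dots,w_d)$,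 where $g(\mathbf w)=\sum_{j=1}^dg_j(w_j)$ with $g_j\in\overline S^{\mathcal B,1}_{(\pi_j,r)}$ and $f\in\overline\Gamma^{\mathcal H,1}_{(t,r)}$. A class $\mathcal F$ of real functions on a set $\mathscr W$ is VC-subgraph with dimension $V$ if $V$ is the largest cardinality of a finite set $\mathcal S\subset\mathscr W\times\mathbb R$ all of whose subsets are of the form $\mathcal S\cap\{(w,y):y<f(w)\}$ with $f\in\mathcal F$. *)

(* Defs.v *)
From HB Require Import structures.
From mathcomp Require Import all_boot all_order all_algebra finmap.
From mathcomp Require Import all_classical all_reals all_analysis.

Set Implicit Arguments.
Unset Strict Implicit.
Unset Printing Implicit Defensive.
Import Order.TTheory GRing.Theory Num.Theory.
Local Open Scope classical_set_scope.
Local Open Scope card_scope.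
Local Open Scope ring_scope.

(* A class of functions on a set W is encoded as a set of total functions, of
   which only the restrictions to W matter: each class below contains, with a
   function, every total function that agrees with it on W. *)

Section Partitions.
Variable R : realType.

(* The first cell [0, 1/n] is closed, the others are ]k/n, (k+1)/n]. *)
Definition cell (n k : nat) : set R :=
  if k is 0%N then `[0, n%:R^-1] else `]k%:R / n%:R, k.+1%:R / n%:R].

(* A partition is the set of its cells. *)
Definition regular_partition (n : nat) : set (set R) :=
  [set cell n k | k in `I_n].

Definition dyadic_partitions : set (set (set R)) :=
  [set regular_partition (2 ^ s) | s in [set: nat]].

(* The number of cells of a finite partition. *)
Definition ncells (pi : set (set R)) : nat := #|` fset_set pi|.

End Partitions.

Arguments cell : clear implicits.
Arguments regular_partition : clear implicits.
Arguments dyadic_partitions : clear implicits.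

Section Classes.
Variable R : realType.

Definition piecewise_poly (pi : set (set R)) (r : nat) : set (R -> R) :=
  [set g | forall I, pi I ->
     exists2 p : {poly R}, (size p <= r.+1)%N & forall x, I x -> g x = p.[x]].

Definition clamp (a b x : R) : R := Num.min (Num.max x a) b.

Definition clamped_piecewise_poly (vm vp : R) (t r : nat) : set (R -> R) :=
  [set f | exists2 g, piecewise_poly (regular_partition R t) r g &
     forall x, `[0, 1]%classic x -> f x = clamp vm vp (g x)].

Definition unit_cube (d : nat) : set 'rV[R]_d :=
  [set w | forall j, `[0, 1]%classic (w 0 j)].

Definition additive_class (vm vp : R) (d : nat) (pi : 'I_d -> set (set R))
    (t r : nat) : set ('rV[R]_d -> R) :=
  [set h | exists f (g : 'I_d -> R -> R),
     [/\ clamped_piecewise_poly vm vp t r f,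
         forall j, piecewise_poly (pi j) r (g j) &
         forall w, unit_cube w -> h w = f (clamp 0 1 (\sum_j g j (w 0 j)))]].

Definition log2 (x : R) : R := ln x / ln 2.

End Classes.

Section VC.
Variables (T : Type) (R : realType).

Definition subgraph (f : T -> R) : set (T * R) := [set wy | wy.2 < f wy.1].

Definition shattered (F : set (T -> R)) (S : set (T * R)) : Prop :=
  forall A, A `<=` S -> exists2 f, F f & A = S `&` subgraph f.

Definition vc_subgraph_dim (W : set T) (F : set (T -> R)) (V : nat) : Prop :=
  (exists S : set (T * R),
     [/\ S `<=` W `*` [set: R], S #= `I_V & shattered F S]) /\
  (forall (S : set (T * R)) (n : nat),
     S `<=` W `*` [set: R] -> S #= `I_n -> shattered F S -> (n <= V)%N).

End VC.

Arguments unit_cube : clear implicits.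

(* Main.v *)
(* The number N of sign patterns realised by m polynomials f_i of degree at most
   D in n variables satisfies N n^n m^m <= D^n (n + m)^(n + m).  For all weights
   k_i > 0 and all c, the function prod_i |f_i|^(k_i) exp (- |x|^2 / 2 - c x) has
   a maximum on the region of each pattern.  With u_i = k_i / f_i(x), maxima
   solve the polynomial system G1 = c, G2 = k in the unknowns (x, u), where
   G1_j = sum_i u_i d_j f_i - x_j and G2_i = u_i f_i have degree D in x and 1 in
   u; so every (c, k) has at least N preimages.  If h is a linear form
   separating them, the polynomials h^j G1^alpha G2^beta, j < N, are linearly
   independent; counting those with |alpha| <= n k, |beta| <= m k against the
   monomials of the same bidegree and letting k grow gives the bound, hence
   N <= (2 e m D / n)^n for n <= m.

   Applied first to the m (t + 1) comparisons of the inner additive functions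
   with the knots h / t (degree 1 in W1 parameters), and then, the pieces being
   fixed, to the m comparisons of the output with the sample levels (degree
   r + 1 in W1 + W2 parameters), it bounds 2^m for a shattered sample of
   size m, and concavity of the logarithm gives 2^m <= (2 e U m / W)^W with
   W = 2 W1 + W2. *)

Require Import Defs.
From HB Require Import structures.
From mathcomp Require Import all_boot all_order all_algebra finmap.
From mathcomp Require Import all_classical all_reals all_analysis.
From mathcomp Require Import zify ring lra.
Import Order.TTheory GRing.Theory Num.Theory.
Import numFieldNormedType.Exports.
Local Open Scope classical_set_scope.
Local Open Scope ring_scope.
Set Implicit Arguments.
Unset Strict Implicit.
Unset Printing Implicit Defensive.

(** * Bigraded polynomial functions *)

Section BigradedPolynomials.
Variables (R : realType) (n m : nat).

(** Degrees are certified by how a function is built, with no coefficients in sight: [A] and [B]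
    bound the degrees in [x] and in [u]. [bipoly_leq] makes both indices mere upper bounds. *)
Inductive bipoly : nat -> nat -> ('rV[R]_n -> 'rV[R]_m -> R) -> Prop :=
| bipoly_cst c : bipoly 0 0 (fun _ _ => c)
| bipoly_x j : bipoly 1 0 (fun x _ => x 0 j)
| bipoly_u i : bipoly 0 1 (fun _ u => u 0 i)
| bipolyD A B F G : bipoly A B F -> bipoly A B G ->
    bipoly A B (fun x u => F x u + G x u)
| bipolyM A B A' B' F G : bipoly A B F -> bipoly A' B' G ->
    bipoly (A + A') (B + B') (fun x u => F x u * G x u)
| bipoly_leq A B A' B' F : (A <= A')%N -> (B <= B')%N ->
    bipoly A B F -> bipoly A' B' F.

Lemma eq_bipoly A B F G : (forall x u, F x u = G x u) ->
  bipoly A B F -> bipoly A B G.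
Proof.
by move=> FG; have -> : F = G by apply/funext => x; apply/funext => u.
Qed.

Lemma bipolyC A B c : bipoly A B (fun _ _ => c).
Proof. by apply: (@bipoly_leq 0 0) => //; constructor. Qed.

Lemma bipolyZ A B c F : bipoly A B F -> bipoly A B (fun x u => c * F x u).
Proof. by move=> FP; apply: (@bipolyM 0 0); [constructor|]. Qed.

Lemma bipoly_sum (I : Type) (r : seq I) (P : pred I) A B F :
  (forall i, P i -> bipoly A B (F i)) ->
  bipoly A B (fun x u => \sum_(i <- r | P i) F i x u).
Proof.
move=> FP; elim: r => [|i r IH].
  by apply: eq_bipoly (bipolyC A B 0) => x u; rewrite big_nil.
have [Pi|nPi] := boolP (P i).
  by apply: eq_bipoly (bipolyD (FP i Pi) IH) => x u; rewrite big_cons Pi.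
by apply: eq_bipoly IH => x u; rewrite big_cons (negbTE nPi).
Qed.

Lemma bipoly_prod (I : Type) (r : seq I) (a b : I -> nat) F :
  (forall i, bipoly (a i) (b i) (F i)) ->
  bipoly (\sum_(i <- r) a i) (\sum_(i <- r) b i)
    (fun x u => \prod_(i <- r) F i x u).
Proof.
move=> FP; elim: r => [|i r IH].
  by rewrite !big_nil; apply: eq_bipoly (bipolyC 0 0 1) => x u; rewrite big_nil.
rewrite !big_cons.
by apply: eq_bipoly (bipolyM (FP i) IH) => x u; rewrite big_cons.
Qed.

Lemma bipolyX A B F k : bipoly A B F ->
  bipoly (A * k) (B * k) (fun x u => F x u ^+ k).
Proof.
move=> FP; elim: k => [|k IH]; first by rewrite !muln0; apply: bipolyC.
by rewrite !mulnS; apply: eq_bipoly (bipolyM FP IH) => x u; rewrite exprS.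
Qed.

(** Exponent vectors of the monomials of degree at most [A]; capping each entry as well makes this a
    finite type. *)
Definition exps p A := {t : p.-tuple 'I_A.+1 | (\sum_(i <- t) i <= A)%N}.

Lemma card_exps p A : #|{: exps p A}| = 'C(p + A, p).
Proof. by rewrite card_sig -(card_partial_ord_partitions p A) cardsE. Qed.

Definition expn_of p A (e : exps p A) (l : 'I_p) : nat := tnth (val e) l.

Lemma sum_expn_of p A (e : exps p A) : (\sum_l expn_of e l <= A)%N.
Proof. by have := valP e; rewrite big_tuple. Qed.

Lemma expn_of_surj p A (a : 'I_p -> nat) : (\sum_l a l <= A)%N ->
  exists e : exps p A, expn_of e =1 a.
Proof.
move=> aA.
have al l : (a l < A.+1)%N.
  by rewrite ltnS (leq_trans _ aA)// (bigD1 l)//= leq_addr.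
have tP : (\sum_(i <- [tuple Ordinal (al l) | l < p]) i <= A)%N.
  rewrite big_tuple; apply: leq_trans aA.
  by apply: leq_sum => l _; rewrite tnth_mktuple.
exists (exist (fun t : p.-tuple 'I_A.+1 => (\sum_(i <- t) i <= A)%N) _ tP) => l.
by rewrite /expn_of tnth_mktuple.
Qed.

Lemma expn_of_inj p A (e e' : exps p A) : expn_of e =1 expn_of e' -> e = e'.
Proof.
by move=> ee'; apply/val_inj/eq_from_tnth => l; apply/val_inj/ee'.
Qed.

Definition monom p (a : 'I_p -> nat) (x : 'rV[R]_p) := \prod_l x 0 l ^+ a l.

Lemma monomD p (a b : 'I_p -> nat) x :
  monom (fun l => a l + b l)%N x = monom a x * monom b x.
Proof. by rewrite -big_split; apply: eq_bigr => l _; rewrite exprD. Qed.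

Definition bispan A B (F : 'rV[R]_n -> 'rV[R]_m -> R) :=
  exists c : exps n A * exps m B -> R, forall x u,
    F x u = \sum_p c p * (monom (expn_of p.1) x * monom (expn_of p.2) u).

Lemma bispan_monom A B (a : 'I_n -> nat) (b : 'I_m -> nat) :
  (\sum_l a l <= A)%N -> (\sum_l b l <= B)%N ->
  bispan A B (fun x u => monom a x * monom b u).
Proof.
move=> /expn_of_surj[e ea] /expn_of_surj[e' eb].
exists (fun p => (p == (e, e'))%:R) => x u.
rewrite (bigD1 (e, e'))//= eqxx mul1r big1 ?addr0; last first.
  by move=> p /negbTE ->; rewrite mul0r.
by congr (_ * _); apply: eq_bigr => l _; rewrite ?ea ?eb.
Qed.

Lemma bispanD A B F G : bispan A B F -> bispan A B G ->
  bispan A B (fun x u => F x u + G x u).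
Proof.
move=> [c Fc] [d Gd]; exists (fun p => c p + d p) => x u.
by rewrite Fc Gd -big_split; apply: eq_bigr => p _; rewrite mulrDl.
Qed.

Lemma bispanZ A B k F : bispan A B F -> bispan A B (fun x u => k * F x u).
Proof.
move=> [c Fc]; exists (fun p => k * c p) => x u.
by rewrite Fc mulr_sumr; apply: eq_bigr => p _; rewrite mulrA.
Qed.

Lemma bispan_sum (I : finType) A B (F : I -> _) : (forall i, bispan A B (F i)) ->
  bispan A B (fun x u => \sum_i F i x u).
Proof.
move=> /choice[c Fc]; exists (fun p => \sum_i c i p) => x u.
under eq_bigr do rewrite Fc; rewrite exchange_big/=.
by apply: eq_bigr => p _; rewrite mulr_suml.
Qed.

Lemma eq_bispan A B F G : (forall x u, F x u = G x u) ->
  bispan A B F -> bispan A B G.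
Proof. by move=> FG [c Fc]; exists c => x u; rewrite -FG Fc. Qed.

Lemma bispanM A B A' B' F G : bispan A B F -> bispan A' B' G ->
  bispan (A + A') (B + B') (fun x u => F x u * G x u).
Proof.
move=> [c Fc] [d Gd].
pose H (pq : (exps n A * exps m B) * (exps n A' * exps m B')) x u : R :=
  c pq.1 * d pq.2 *
  (monom (fun l => expn_of pq.1.1 l + expn_of pq.2.1 l)%N x *
   monom (fun l => expn_of pq.1.2 l + expn_of pq.2.2 l)%N u).
apply: (@eq_bispan _ _ (fun x u => \sum_pq H pq x u)).
  move=> x u; rewrite Fc Gd mulr_suml.
  rewrite -(pair_big xpredT xpredT (fun p q => H (p, q) x u))/=.
  apply: eq_bigr => p _; rewrite mulr_sumr; apply: eq_bigr => q _.
  by rewrite /H !monomD; ring.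
apply: bispan_sum => pq; apply: bispanZ; apply: bispan_monom.
  by rewrite big_split leq_add ?sum_expn_of.
by rewrite big_split leq_add ?sum_expn_of.
Qed.

Lemma bispan_leq A B A' B' F : (A <= A')%N -> (B <= B')%N ->
  bispan A B F -> bispan A' B' F.
Proof.
move=> AA' BB' [c Fc].
pose H (p : exps n A * exps m B) x u :=
  c p * (monom (expn_of p.1) x * monom (expn_of p.2) u).
apply: (@eq_bispan _ _ (fun x u => \sum_p H p x u)); first by move=> x u.
apply: bispan_sum => p; apply: bispanZ; apply: bispan_monom.
  exact: leq_trans (sum_expn_of _) AA'.
exact: leq_trans (sum_expn_of _) BB'.
Qed.

Lemma bipoly_bispan A B F : bipoly A B F -> bispan A B F.
Proof.
have mon0 p x : monom (fun _ : 'I_p => 0%N) x = 1.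
  by apply: big1 => l _; rewrite expr0.
have sum0 p A0 : (\sum_(l < p) 0 <= A0)%N by rewrite big1.
have mon1 p x j : monom (fun l : 'I_p => (l == j) : nat) x = x 0 j.
  rewrite /monom (bigD1 j)//= eqxx expr1 big1 ?mulr1// => l /negbTE ->.
  by rewrite expr0.
have sum1 p (j : 'I_p) : (\sum_(l < p) (l == j) <= 1)%N.
  by rewrite (bigD1 j)//= eqxx big1// => l /negbTE ->.
elim=> {A B F}.
- move=> c; apply: eq_bispan (bispanZ c (bispan_monom (sum0 _ _) (sum0 _ _))).
  by move=> x u /=; rewrite !mon0 !mulr1.
- move=> j; apply: eq_bispan (bispan_monom (sum1 _ j) (sum0 _ _)).
  by move=> x u /=; rewrite mon0 mon1 mulr1.
- move=> j; apply: eq_bispan (bispan_monom (sum0 _ _) (sum1 _ j)).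
  by move=> x u /=; rewrite mon0 mon1 mul1r.
- by move=> A B F G _ ? _ ?; apply: bispanD.
- by move=> A B A' B' F G _ ? _ ?; apply: bispanM.
- by move=> A B A' B' F ? ? _; apply: bispan_leq.
Qed.

(** There are more functions than monomials, so the matrix of coefficients has more rows than
    columns; a nonzero vector of its left kernel is the relation. *)
Lemma bipoly_dependent (I : finType) A B (F : I -> _) :
  (forall i, bipoly A B (F i)) -> ('C(n + A, n) * 'C(m + B, m) < #|I|)%N ->
  exists c : I -> R, (exists i, c i != 0) /\
    forall x u, \sum_i c i * F i x u = 0.
Proof.
move=> FP; rewrite -!card_exps -card_prod => ltI.
have /choice[C FC] := fun i => bipoly_bispan (FP i).
pose M := \matrix_(i < #|I|, p < #|{: exps n A * exps m B}|)
  C (enum_val i) (enum_val p).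
have : kermx M != 0.
  rewrite -mxrank_eq0 mxrank_ker -lt0n subn_gt0.
  exact: leq_ltn_trans (rank_leq_col M) ltI.
case/rowV0Pn => v /sub_kermxP vM /rV0Pn[i0 vi0].
exists (fun i => v 0 (enum_rank i)); split.
  by exists (enum_val i0); rewrite enum_valK.
move=> x u.
under eq_bigr do rewrite FC mulr_sumr; rewrite exchange_big/=.
apply: big1 => p _; under eq_bigr do rewrite mulrA; rewrite -mulr_suml.
have /matrixP/(_ 0 (enum_rank p)) := vM; rewrite !mxE => vMp.
rewrite (reindex (@enum_val _ I)) /=; last first.
  by apply: onW_bij; apply: enum_val_bij.
rewrite [X in X * _](_ : _ = 0) ?mul0r// -[RHS]vMp.
by apply: eq_bigr => i _; rewrite enum_valK mxE enum_rankK.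
Qed.

End BigradedPolynomials.

(** * Degree of a polynomial map *)

(** Uniqueness of base-[B] expansions, by peeling off the lowest digit. It supports the Kronecker
    substitution that packs an exponent vector into one exponent. *)
Lemma base_code_inj p B (a b : 'I_p -> nat) :
  (forall l, (a l < B)%N) -> (forall l, (b l < B)%N) ->
  (\sum_l a l * B ^ l = \sum_l b l * B ^ l)%N -> a =1 b.
Proof.
elim: p a b => [|p IH] a b aB bB; first by move=> _ [].
have shift (c : 'I_p.+1 -> nat) : (\sum_l c l * B ^ l =
    c ord0 + (\sum_(l < p) c (lift ord0 l) * B ^ l) * B)%N.
  rewrite big_ord_recl expn0 muln1 big_distrl/=; congr (_ + _)%N.
  by apply: eq_bigr => l _; rewrite -mulnA -expnSr.
rewrite !shift => eqab.
have B0 : (0 < B)%N by apply: leq_ltn_trans (aB ord0).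
have ab0 : a ord0 = b ord0.
  have := congr1 (modn^~ B) eqab.
  by rewrite -!(addnC (_ * B)%N) !modnMDl !modn_small.
move: eqab; rewrite ab0 => /addnI/eqP; rewrite eqn_pmul2r// => /eqP eqab.
have {}IH := IH _ _ (fun l => aB (lift ord0 l)) (fun l => bB (lift ord0 l)) eqab.
by move=> l; case: (unliftP ord0 l) => [l'|] ->//; apply: IH.
Qed.

Lemma infinite_pigeonhole (I : finType) (f : nat -> I) :
  exists i, forall B, exists2 y, (B <= y)%N & f y = i.
Proof.
apply: contrapT => /forallNP H.
have /choice[B HB] : forall i, exists B, forall y, (B <= y)%N -> f y <> i.
  move=> i; have /existsNP[B HB] := H i; exists B => y By fy.
  by apply: HB; exists y.
pose y := \max_i B i.
by apply: (HB (f y) y) => //; apply: leq_bigmax.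
Qed.

Lemma poly0_of_nat_roots (R : realType) (p : {poly R}) :
  (forall B, exists2 y : nat, (B <= y)%N & root p y%:R) -> p = 0.
Proof.
move=> H; apply/eqP/negP => /negP p0.
suff [s [us rs]] : exists s : seq nat,
    [/\ uniq s, all (fun y => root p y%:R) s & size s = size p].
  move=> ss.
  have := @max_poly_roots R p [seq y%:R | y <- s] p0.
  rewrite all_map map_inj_uniq; last by move=> ? ? /eqP; rewrite eqr_nat => /eqP.
  by move=> /(_ rs us); rewrite size_map ss ltnn.
elim: (size p) => [|k [s [us rs ss]]]; first by exists [::].
have [y By ry] := H (\max_(z <- s) z).+1.
exists (y :: s); rewrite /= us rs ry ss; split => //; rewrite andbT.
apply: contraL By => ys; rewrite -ltnNge ltnS.
by rewrite (big_rem y)//= leq_maxl.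
Qed.

Section Separation.
Variables (R : realType) (n : nat) (T : finType).

(** The linear form whose coefficients are the point of parameter [s] on the moment curve. *)
Definition curve_form (s : nat) (x : 'rV[R]_n) : R := \sum_l x 0 l * s%:R ^+ l.

(** For two distinct points, the difference of the forms is a nonzero polynomial in [s] of degree
    below [n]. The product over all pairs has fewer roots than there are candidates for [s]. The
    finite range of [s] permits a pigeonhole argument in [fiber_count]. *)
Lemma curve_form_separates (x : T -> 'rV[R]_n) : injective x ->
  exists s : 'I_(#|T| * #|T| * n).+1, injective (fun t => curve_form s (x t)).
Proof.
move=> xI; pose p (st : T * T) := \poly_(l < n)
  (if insub l is Some i then (x st.1 - x st.2) 0 i else 0 : R).
have pE st s : (p st).[s%:R] = curve_form s (x st.1) - curve_form s (x st.2).
  rewrite /curve_form horner_poly -sumrB; apply: eq_bigr => i _.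
  by rewrite valK !mxE mulrBl.
have p0 st : st.1 != st.2 -> p st != 0.
  apply: contraNneq => p0; apply/eqP/xI/rowP => i.
  have /polyP/(_ i) := p0; rewrite coef_poly ltn_ord valK coef0 !mxE => /eqP.
  by rewrite subr_eq0 => /eqP.
pose q := \prod_(st | st.1 != st.2) p st.
have q0 : q != 0 by apply/prodf_neq0 => st; apply: p0.
have qs : (size q <= (#|T| * #|T| * n).+1)%N.
  apply: leq_trans (size_prod_leq _ _) _; rewrite leq_subLR.
  apply: leq_trans (leq_addl _ _); rewrite ltnS.
  rewrite -card_prod -sum_nat_const [leqRHS](bigID (fun st => st.1 != st.2))/=.
  by apply: leq_trans (leq_addr _ _); apply: leq_sum => st _; apply: size_poly.
have /allPn[_ /mapP[s s_in ->] nrs] :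
    ~~ all (root q) [seq s%:R | s <- iota 0 (#|T| * #|T| * n).+1].
  apply/negP => /(max_poly_roots q0).
  rewrite map_inj_uniq ?iota_uniq; last first.
    by move=> ? ? /eqP; rewrite eqr_nat => /eqP.
  by rewrite size_map size_iota => /(_ isT); rewrite ltnNge qs.
move: s_in; rewrite mem_iota add0n => /= sM.
exists (Ordinal sM) => t t' /= eqtt'; apply/eqP; apply: contraNT nrs => tt'.
rewrite /root horner_prod (bigD1 (t, t'))//= pE/= eqtt' subrr mul0r//.
Qed.

End Separation.

Section FiberCount.
Variables (R : realType) (n m D : nat) (T : finType).
Variables (G1 : 'I_n -> 'rV[R]_n -> 'rV[R]_m -> R).
Variables (G2 : 'I_m -> 'rV[R]_n -> 'rV[R]_m -> R).
Hypothesis G1P : forall j, bipoly D 1 (G1 j).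
Hypothesis G2P : forall i, bipoly D 1 (G2 i).
Hypothesis fiber : forall (c : 'I_n -> R) (k : 'I_m -> nat),
  (forall i, (0 < k i)%N) ->
  exists (x : T -> 'rV[R]_n) (u : T -> 'rV[R]_m), injective x /\
    forall t, (forall j, G1 j (x t) (u t) = c j) /\
              (forall i, G2 i (x t) (u t) = (k i)%:R).

(* The products [h ^ j * G1 ^ alpha * G2 ^ beta] with [j < #|T|], where [h] is a
   linear form separating the fibers, are linearly independent. *)
Lemma fiber_count a b :
  (#|T| * ('C(n + a, n) * 'C(m + b, m)) <=
   'C(n + (D * (a + b) + #|T|), n) * 'C(m + (a + b), m))%N.
Proof.
rewrite leqNgt; apply/negP => ltC.
pose E := (exps n a * exps m b)%type.
(* A base larger than every exponent in [alpha] or [beta], so that [code] is injective. *)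
pose B := (a + b).+1.
pose gam (e : E) (l : 'I_(n + m)) : nat :=
  match fintype.split l with inl j => expn_of e.1 j | inr i => expn_of e.2 i end.
pose code (e : E) := (\sum_l gam e l * B ^ l)%N.
have gamB e l : (gam e l < B)%N.
  rewrite /gam /B ltnS; case: (fintype.split l) => j.
    apply: leq_trans (leq_addr _ _); apply: leq_trans (sum_expn_of e.1).
    by rewrite (bigD1 j)//= leq_addr.
  apply: leq_trans (leq_addl _ _); apply: leq_trans (sum_expn_of e.2).
  by rewrite (bigD1 j)//= leq_addr.
have code_inj : injective code.
  move=> e e' /(base_code_inj (gamB e) (gamB e')) ee'.
  apply: injective_projections; apply: expn_of_inj => j.
    by have := ee' (lshift m j); rewrite /gam (unsplitK (inl j)).
  by have := ee' (rshift n j); rewrite /gam (unsplitK (inr j)).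
pose F s (je : 'I_#|T| * E) x u : R := curve_form s x ^+ je.1 *
  ((\prod_j G1 j x u ^+ expn_of je.2.1 j) *
   (\prod_i G2 i x u ^+ expn_of je.2.2 i)).
have FP s je : bipoly (D * (a + b) + #|T|) (a + b) (F s je).
  have hP : bipoly 1 0 (fun (x : 'rV[R]_n) (_ : 'rV[R]_m) => curve_form s x).
    rewrite /curve_form; apply: bipoly_sum => l _.
    by apply: eq_bipoly (bipolyZ (s%:R ^+ l) (@bipoly_x R n m l)) => x u; rewrite mulrC.
  have P1 := bipoly_prod (index_enum 'I_n) (fun j => bipolyX (expn_of je.2.1 j) (G1P j)).
  have P2 := bipoly_prod (index_enum 'I_m) (fun i => bipolyX (expn_of je.2.2 i) (G2P i)).
  apply: bipoly_leq (bipolyM (bipolyX je.1 hP) (bipolyM P1 P2)).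
    rewrite -!big_distrr/= mul1n addnC -mulnDr leq_add// ?leq_mul ?leq_add//;
      by [exact: sum_expn_of|exact: ltnW].
  by rewrite -!big_distrr/= mul0n !mul1n add0n leq_add// sum_expn_of.
have cardI : ('C(n + (D * (a + b) + #|T|), n) * 'C(m + (a + b), m) <
    #|{: 'I_#|T| * E}|)%N.
  by rewrite !card_prod card_ord !card_exps.
have /choice[c cP] := fun s => bipoly_dependent (FP s) cardI.
(* On this curve of parameters (c, k), distinct monomials have distinct
   degrees in the variable y + 1. *)
pose cc (y : nat) (j : 'I_n) : R := y.+1%:R ^+ (B ^ j).
pose kk (y : nat) (i : 'I_m) : nat := (y.+1 ^ (B ^ (n + i)))%N.
have kk0 y i : (0 < kk y i)%N by rewrite expn_gt0.
have /choice[s sP] : forall y, exists s : 'I_(#|T| * #|T| * n).+1,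
    forall j, \sum_e c s (j, e) * y.+1%:R ^+ code e = 0.
  move=> y; have [x [u [xI xu]]] := fiber (cc y) (kk0 y).
  have [s sI] := curve_form_separates xI; exists s.
  (* On a fiber the [G1] and [G2] are constant, so the relation becomes a polynomial [P] in the
     value of [h], of degree below [#|T|]. It vanishes at the [#|T|] distinct values of [h] on the
     fiber. *)
  pose P := \poly_(j < #|T|) (if insub j is Some j'
    then \sum_e c s (j', e) * y.+1%:R ^+ code e else 0).
  suff P0 : P = 0.
    by move=> j; have /polyP/(_ j) := P0; rewrite coef_poly ltn_ord valK coef0.
  apply: (@roots_geq_poly_eq0 _ _ [seq curve_form s (x t) | t : T]).
  - apply/allP => _ /mapP[t _ ->]; apply/rootP.
    rewrite horner_poly -[RHS]((cP s).2 (x t) (u t)).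
    transitivity (\sum_j \sum_e c s (j, e) * F s (j, e) (x t) (u t)); last first.
      by rewrite pair_bigA/=; apply: eq_bigr => -[].
    apply: eq_bigr => j _; rewrite valK mulr_suml; apply: eq_bigr => e _.
    rewrite /F/= -mulrA; congr (_ * _); rewrite mulrC; congr (_ * _).
    rewrite /code -[LHS]prodrXr big_split_ord/=; congr (_ * _).
      apply: eq_bigr => l _.
      by rewrite (xu t).1 /cc -exprM mulnC /gam (unsplitK (inl l)).
    apply: eq_bigr => l _.
    by rewrite (xu t).2 /kk natrX -exprM mulnC /gam (unsplitK (inr l)).
  - by rewrite /image_mem map_inj_uniq ?enum_uniq.
  - by rewrite size_map -cardE size_poly.
(* The separating form varies with [y], but one [s0] serves arbitrarily large [y]; hence [Q] below
   has infinitely many roots. *)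
have [s0 s0P] := infinite_pigeonhole s.
have [[je cje0] _] := cP s0.
pose Q := \sum_e c s0 (je.1, e) *: 'X^(code e).
have Q0 : Q = 0.
  apply: poly0_of_nat_roots => B0; have [y By sy] := s0P B0.
  exists y.+1; first exact: leqW.
  apply/rootP; rewrite horner_sum -[RHS](sP y je.1) sy.
  by apply: eq_bigr => e _; rewrite hornerZ hornerXn.
move/eqP: cje0; apply.
have /polyP/(_ (code je.2)) := Q0; rewrite coef0 coef_sum (bigD1 je.2)//=.
rewrite coefZ coefXn eqxx mulr1 big1 ?addr0; last first.
  move=> e ne; rewrite coefZ coefXn (_ : _ == _ = false) ?mulr0//.
  by apply: contraNF ne => /eqP/code_inj ->.
by case: (je).
Qed.

End FiberCount.

Lemma ffact_leq_exp a n : (a ^_ n <= a ^ n)%N.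
Proof.
elim: n a => [//|n IH] a; rewrite ffactnS expnS leq_mul2l; apply/orP; right.
by apply: leq_trans (IH _) _; case: n {IH} => // n; rewrite leq_exp2r// leq_pred.
Qed.

Lemma exp_leq_ffact a n : (a ^ n <= (n + a) ^_ n)%N.
Proof.
elim: n => [//|n IH].
by rewrite addSn ffactSS expnS leq_mul// -addSn leq_addl.
Qed.

(* The ratio n : m between the two degrees is the one that optimises the
   limit. *)
Lemma fiber_count_limit (R : realType) (n m D N : nat) :
  (forall k, (N * ('C(n + n * k, n) * 'C(m + m * k, m)) <=
   'C(n + (D * (n * k + m * k) + N), n) * 'C(m + (n * k + m * k), m))%N) ->
  (N * (n ^ n * m ^ m) <= D ^ n * (n + m) ^ (n + m))%N.
Proof.
move=> H.
have H1 k : (N * ((n * k) ^ n * (m * k) ^ m) <=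
    (n + (D * (n * k + m * k) + N)) ^ n * (m + (n * k + m * k)) ^ m)%N.
  apply: (@leq_trans (N * ((n + n * k) ^_ n * (m + m * k) ^_ m))).
    by rewrite leq_mul2l leq_mul ?exp_leq_ffact ?orbT.
  rewrite -!bin_ffact mulnACA mulnA.
  apply: (@leq_trans ('C(n + (D * (n * k + m * k) + N), n) *
      'C(m + (n * k + m * k), m) * (n`! * m`!))).
    by rewrite leq_mul2r H orbT.
  by rewrite mulnACA !bin_ffact leq_mul ?ffact_leq_exp.
(* The right-hand side of [H1], divided by [k ^ (n + m)], is the value of [p] at [1 / k]; its limit
   is [p.[0]]. *)
pose p : {poly R} := ((D * (n + m))%:R%:P + (n + N)%:R *: 'X) ^+ n *
  ((n + m)%:R%:P + m%:R *: 'X) ^+ m.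
have pE s : p.[s] = ((D * (n + m))%:R + (n + N)%:R * s) ^+ n *
    ((n + m)%:R + m%:R * s) ^+ m.
  by rewrite /p hornerM !horner_exp !hornerE.
suff : (N * (n ^ n * m ^ m))%:R <= p.[0].
  by rewrite pE !mulr0 !addr0 -!natrX -natrM ler_nat expnMn -mulnA -expnD.
apply: (@cvgr_to_ge _ \oo _ R (fun k => p.[harmonic k])).
  by apply: continuous_cvg cvg_harmonic; apply: continuous_horner.
apply: nearW => k; rewrite /= pE.
have k0 : (0 : R) < k.+1%:R by rewrite ltr0n.
have kE a b : a%:R + b%:R * k.+1%:R^-1 = (a * k.+1 + b)%:R / k.+1%:R :> R.
  by rewrite natrD natrM mulrDl mulfK ?gt_eqF.
rewrite !kE !expr_div_n mulf_div -exprD ler_pdivlMr ?exprn_gt0//.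
rewrite -!natrX -!natrM ler_nat.
have := H1 k.+1; rewrite !expnMn mulnACA -expnD mulnA => /leq_trans; apply.
apply: eq_leq; congr (_ ^ _ * _ ^ _)%N; ring.
Qed.

(** * Critical points *)

Section PolynomialFunctions.
Variables (R : realType) (n : nat).

(* The number of idle variables is left free, so that [f] can be mixed with
   any family of multipliers. *)
Definition polyfun D (f : 'rV[R]_n -> R) :=
  forall m, @bipoly R n m D 0 (fun x _ => f x).

(** [G] is the partial derivative along coordinate [j], obtained algebraically: on each line
    parallel to that axis [F] is a univariate polynomial, and the sum and product rules preserve the
    degree bounds. *)
Lemma bipoly_partial m A B F (j : 'I_n) : @bipoly R n m A B F ->
  exists2 G, @bipoly R n m A B G & forall x u, exists2 p : {poly R},
    forall t, F (x + t *: delta_mx 0 j) u = p.[t] & p^`().[0] = G x u.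
Proof.
elim=> {A B F}.
- move=> c; exists (fun _ _ => 0); first exact: bipolyC.
  by move=> x u; exists c%:P => [t|]; rewrite ?derivC !hornerE.
- move=> i; exists (fun _ _ => (i == j)%:R); first exact: bipolyC.
  move=> x u; exists ((x 0 i)%:P + (i == j)%:R *: 'X) => [t|].
    by rewrite !mxE/= !hornerE mulrC.
  by rewrite derivD derivC derivZ derivX !hornerE.
- move=> i; exists (fun _ _ => 0); first exact: bipolyC.
  by move=> x u; exists (u 0 i)%:P => [t|]; rewrite ?derivC !hornerE.
- move=> A B F G _ [F' F'P FF'] _ [G' G'P GG'].
  exists (fun x u => F' x u + G' x u); first exact: bipolyD.
  move=> x u; have [p Fp p'] := FF' x u; have [q Gq q'] := GG' x u.
  by exists (p + q) => [t|]; rewrite ?derivD hornerD ?Fp ?Gq ?p' ?q'.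
- move=> A B A' B' F G FP [F' F'P FF'] GP [G' G'P GG'].
  exists (fun x u => F' x u * G x u + F x u * G' x u).
    by apply: bipolyD; apply: bipolyM.
  move=> x u; have [p Fp p'] := FF' x u; have [q Gq q'] := GG' x u.
  exists (p * q) => [t|]; first by rewrite hornerM Fp Gq.
  by rewrite derivM !hornerE p' q' -Fp -Gq scale0r addr0.
- move=> A B A' B' F AA' BB' _ [G GP FG].
  by exists G => //; apply: bipoly_leq GP.
Qed.

Lemma bipoly_continuous m A B F u : @bipoly R n m A B F ->
  continuous (fun x => F x u).
Proof.
elim=> {A B F}.
- by move=> c; apply: cst_continuous.
- by move=> i; apply: coord_continuous.
- by move=> i; apply: cst_continuous.
- by move=> A B F G _ cF _ cG x; apply: continuousD; [apply: cF|apply: cG].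
- by move=> A B A' B' F G _ cF _ cG x; apply: continuousM; [apply: cF|apply: cG].
- by [].
Qed.

Definition l1norm (x : 'rV[R]_n) := \sum_j `|x 0 j|.

Lemma l1norm_ge0 x : 0 <= l1norm x.
Proof. exact: sumr_ge0. Qed.

Lemma l1norm_ge_coord (x : 'rV[R]_n) j : `|x 0 j| <= l1norm x.
Proof. by rewrite /l1norm (bigD1 j)//= lerDl sumr_ge0. Qed.

Lemma bipoly_growth m A B F u : @bipoly R n m A B F ->
  exists2 C, 0 <= C & forall x, `|F x u| <= C * (1 + l1norm x) ^+ A.
Proof.
elim=> {A B F}.
- by move=> c; exists `|c| => // x; rewrite expr0 mulr1.
- move=> i; exists 1 => // x; rewrite expr1 mul1r.
  by rewrite (le_trans (l1norm_ge_coord x i))// lerDr.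
- by move=> i; exists `|u 0 i| => // x; rewrite expr0 mulr1.
- move=> A B F G _ [C C0 FC] _ [C' C'0 GC'].
  exists (C + C') => [|x]; first exact: addr_ge0.
  by rewrite mulrDl (le_trans (ler_normD _ _))// lerD.
- move=> A B A' B' F G _ [C C0 FC] _ [C' C'0 GC'].
  exists (C * C') => [|x]; first exact: mulr_ge0.
  by rewrite normrM exprD mulrACA ler_pM.
- move=> A B A' B' F AA' BB' _ [C C0 FC]; exists C => // x.
  rewrite (le_trans (FC x))// ler_wpM2l// ler_weXn2l//.
  by rewrite lerDl l1norm_ge0.
Qed.

Variable c : 'I_n -> R.

Definition gauss (x : 'rV[R]_n) := \sum_j (x 0 j ^+ 2 / 2 + c j * x 0 j).

Lemma gauss_polyfun : polyfun 2 gauss.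
Proof.
move=> m; apply: bipoly_sum => j _; apply: bipolyD.
  apply: eq_bipoly (bipolyZ 2^-1 (bipolyX 2 (@bipoly_x R n m j))) => x u.
  by rewrite mulrC.
by apply: bipolyZ; apply: bipoly_leq (@bipoly_x R n m j).
Qed.

(** Coordinatewise, the constant comes from expanding the square of [|x_j| - (1 + |c_j|)]. *)
Lemma gauss_ge : exists C, forall x, l1norm x - C <= gauss x.
Proof.
exists (\sum_j (1 + `|c j|) ^+ 2 / 2) => x.
rewrite /l1norm /gauss -sumrB; apply: ler_sum => j _.
have := sqr_ge0 (`|x 0 j| - (1 + `|c j|)).
have : - (c j * x 0 j) <= `|c j| * `|x 0 j| by rewrite -normrM ler_normr lexx orbT.
have : x 0 j ^+ 2 = `|x 0 j| ^+ 2 by rewrite real_normK// num_real.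
set y := `|x 0 j|; set k := `|c j| => ->; nra.
Qed.

Lemma gauss_decay K P : polyfun K P -> exists2 C, 0 < C &
  forall x, P x * expR (- gauss x) <= C / (1 + l1norm x).
Proof.
move=> /(_ 0)/(bipoly_growth 0)[C C0 PC]; have [C' gC'] := gauss_ge.
(* [expR 1] pays for the 1 in [s = 1 + l1norm x]; the last [+ 1] makes the constant strictly
   positive. *)
exists (C * expR C' * expR 1 * K.+1%:R ^+ K.+1 + 1).
  by rewrite ltr_wpDl// !mulr_ge0 ?expR_ge0 ?exprn_ge0.
move=> x; set s := 1 + l1norm x.
have s0 : 0 < s by rewrite ltr_pwDl// l1norm_ge0.
have k0 : 0 < K.+1%:R :> R by rewrite ltr0n.
rewrite ler_pdivlMr//.
(* This is the inequality [s / K.+1 <= expR (s / K.+1)] raised to the power [K.+1]. *)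
have ges : s ^+ K.+1 * expR (- s) <= K.+1%:R ^+ K.+1.
  rewrite expRN ler_pdivrMr ?expR_gt0//.
  have -> : expR s = expR (s / K.+1%:R) ^+ K.+1.
    by rewrite -expRM_natl mulrC divfK ?gt_eqF.
  rewrite -exprMn lerXn2r ?nnegrE ?mulr_ge0 ?expR_ge0 ?(ltW s0) ?(ltW k0)//.
  rewrite -ler_pdivrMl// [leLHS]mulrC (le_trans _ (expR_ge1Dx _))//.
  by rewrite lerDr.
apply: (@le_trans _ _ (C * s ^+ K * (expR C' * expR 1 * expR (- s)) * s)).
  rewrite ler_pM2r// (le_trans (ler_wpM2r _ (ler_norm _))) ?expR_ge0//.
  rewrite ler_pM ?expR_ge0// -!expRD ler_expR.
  have := gC' x; rewrite /s; lra.
rewrite [leLHS](_ : _ = C * expR C' * expR 1 * (s ^+ K.+1 * expR (- s))).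
  by rewrite ler_wpDr// ler_wpM2l// !mulr_ge0 ?expR_ge0.
by rewrite exprS; ring.
Qed.

(** The weight decays at infinity, so it attains a maximum over the closed region [0 <= g i] inside
    a large cube. That maximum is at least the positive value at [x0], whereas [P] vanishes wherever
    some [g i] does; the maximizer is therefore interior to the region. *)
Lemma gauss_maximizer (m D K : nat) (g : 'I_m -> 'rV[R]_n -> R) P x0 :
  (forall i, polyfun D (g i)) -> polyfun K P ->
  (forall i, 0 < g i x0) ->
  (forall x, (forall i, 0 < g i x) -> 0 < P x) ->
  (forall x i, g i x = 0 -> P x = 0) ->
  exists2 x, forall i, 0 < g i x & forall y, (forall i, 0 < g i y) ->
    P y * expR (- gauss y) <= P x * expR (- gauss x).
Proof.
move=> gP PP gx0 Ppos P0.
pose Psi x := P x * expR (- gauss x).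
have cont F E : polyfun E F -> continuous F.
  by move=> /(_ 0)/(@bipoly_continuous _ _ _ _ 0).
have Psix0 : 0 < Psi x0 by rewrite mulr_gt0 ?Ppos ?expR_gt0.
have [C C0 PC] := gauss_decay PP.
(* Beyond radius [b] the decay bound falls below [Psi x0]; the second summand keeps [x0] in the
   cube. *)
pose b := C / Psi x0 + l1norm x0.
have far x : b < l1norm x -> Psi x < Psi x0.
  move=> bx; apply: le_lt_trans (PC x) _.
  have s0 : 0 < 1 + l1norm x by rewrite ltr_pwDl// l1norm_ge0.
  rewrite ltr_pdivrMr// -ltr_pdivrMl// mulrC.
  have := l1norm_ge0 x0; move: bx; rewrite /b; lra.
pose A := [set x : 'rV[R]_n | forall j, `[- b, b]%classic (x ord0 j)]
  `&` \bigcap_(i in [set: 'I_m]) [set x | 0 <= g i x].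
have b0 : l1norm x0 <= b by rewrite lerDr divr_ge0// ltW.
have Ax0 : A x0.
  split=> [j|i _] /=; last exact: ltW.
  by rewrite in_itv/= -ler_norml (le_trans (l1norm_ge_coord _ _)).
have cA : compact A.
  apply: compact_closedI.
    by apply: (rV_compact (A := fun=> `[- b, b]%classic)) => _; apply: segment_compact.
  apply: closed_bigI => i _.
  apply: (preimage_closed _ (@closed_ge R 0)) => y _.
  exact: (cont _ D (gP i)).
have [|x xA xmax] := compact_EVT_max (f := Psi) (ex_intro _ x0 Ax0) cA.
  apply: continuous_subspaceT => y; rewrite /Psi.
  apply: (@continuousM _ _ P (fun y => expR (- gauss y))); first exact: (cont _ K PP).
  apply: (@continuous_comp _ _ _ (fun y => - gauss y) expR).
    by apply: continuousN; apply: (cont _ 2%N gauss_polyfun).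
  exact: continuous_expR.
have Psix : Psi x0 <= Psi x by apply: xmax; rewrite inE.
move: xA; rewrite inE => -[_ xg].
exists x => [i|y gy].
  rewrite lt_neqAle xg// andbT eq_sym; apply: contraTneq (lt_le_trans Psix0 Psix).
  by move=> /P0; rewrite /Psi => ->; rewrite mul0r ltxx.
have [yb|/far/ltW/le_trans] := leP (l1norm y) b; last by apply.
apply: xmax; rewrite inE; split=> [j|i _] /=; last exact: ltW.
by rewrite in_itv/= -ler_norml (le_trans (l1norm_ge_coord _ _)).
Qed.

End PolynomialFunctions.

Lemma deriv_prod_exp (R : fieldType) (I : Type) (r : seq I) (p : I -> {poly R})
    (k : I -> nat) (a : R) :
  (forall i, (p i).[a] != 0) ->
  (\prod_(i <- r) p i ^+ k i)^`().[a] =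
  (\prod_(i <- r) p i ^+ k i).[a] *
    \sum_(i <- r) (k i)%:R * ((p i)^`().[a] / (p i).[a]).
Proof.
move=> p0; elim: r => [|i r IH]; first by rewrite !big_nil derivC hornerC mulr0.
rewrite !big_cons derivM hornerD !hornerM IH mulrDr; congr (_ + _); last by ring.
rewrite deriv_exp hornerMn hornerM !horner_exp.
case: (k i) => [|l]; first by rewrite !mulr0n !mul0r mulr0.
by rewrite exprS -mulr_natl; field.
Qed.

(** * Critical points attached to strict sign patterns *)

Section SignPatterns.
Variables (R : realType) (n m D : nat) (f : 'I_m -> 'rV[R]_n -> R).
Hypothesis D0 : (0 < D)%N.
Hypothesis fP : forall i, polyfun D (f i).

Definition realizes (s : {ffun 'I_m -> bool}) (x : 'rV[R]_n) :=
  forall i, f i x != 0 /\ (0 < f i x) = s i.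

Lemma gauss_line (c : 'I_n -> R) x j t :
  gauss c (x + t *: delta_mx 0 j) =
  gauss c x + (x 0 j + c j) * t + t ^+ 2 / 2.
Proof.
rewrite /gauss (bigD1 j)//= [in RHS](bigD1 j)//= !mxE !eqxx/=.
rewrite (eq_bigr (fun l => x 0 l ^+ 2 / 2 + c l * x 0 l)); last first.
  by move=> l /negbTE lj; rewrite !mxE lj mulr0 addr0.
by field.
Qed.

(* The critical point equations of
   [\prod_i `|f i| ^ k i * exp (- |x| ^ 2 / 2 - c x)], cleared of denominators
   by means of the multipliers [u i = k i / f i x]. *)
Lemma critical_point (df : 'I_m -> 'I_n -> 'rV[R]_n -> R)
    (c : 'I_n -> R) (k : 'I_m -> nat) s :
  (forall i j x, exists2 p : {poly R},
     forall t, f i (x + t *: delta_mx 0 j) = p.[t] & p^`().[0] = df i j x) ->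
  (forall i, 0 < k i)%N -> (exists x, realizes s x) ->
  exists (x : 'rV[R]_n) (u : 'rV[R]_m), [/\ realizes s x,
    forall j, \sum_i u 0 i * df i j x - x 0 j = c j &
    forall i, u 0 i * f i x = (k i)%:R].
Proof.
move=> dfP k0 [x0 sx0].
(* Multiplying by the prescribed signs turns the pattern into a region of positivity. *)
pose sg i : R := (-1) ^+ (~~ s i); pose g i x := sg i * f i x.
have gE x : (forall i, 0 < g i x) <-> realizes s x.
  split=> H i; have := H i; rewrite /g /sg; case: (s i) => /=.
  - by rewrite expr0 mul1r => fx; split=> //; rewrite gt_eqF.
  - rewrite expr1 mulN1r oppr_gt0 => fx; split; first by rewrite lt_eqF.
    by apply/negbTE; rewrite -leNgt ltW.
  - by case=> _ fx; rewrite expr0 mul1r.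
  - by case=> fx fx'; rewrite expr1 mulN1r oppr_gt0 lt_neqAle fx leNgt fx'.
pose P x := \prod_i g i x ^+ k i.
have gP i : polyfun D (g i) by move=> p; apply/bipolyZ/fP.
have PP : polyfun (\sum_i D * k i) P.
  move=> p; have := bipoly_prod (index_enum 'I_m) (fun i => bipolyX (k i) (gP i p)).
  by apply: bipoly_leq => //; rewrite big1.
have [|||x xg xmax] := gauss_maximizer c gP PP (x0 := x0).
- by apply/gE.
- by move=> x xg; apply: prodr_gt0 => i _; rewrite exprn_gt0.
- by move=> x i gx0; rewrite /P (bigD1 i)//= gx0 expr0n eqn0Ngt k0 mul0r.
have sx := (gE x).1 xg.
have fx0 i : f i x != 0 by have [] := sx i.
exists x, (\row_i ((k i)%:R / f i x)); split=> // [j|i]; last first.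
  by rewrite mxE divfK.
have /choice[p pP] : forall i, exists p : {poly R},
    (forall t, f i (x + t *: delta_mx 0 j) = p.[t]) /\ p^`().[0] = df i j x.
  by move=> i; have [p] := dfP i j x; exists p.
have p0E i : (p i).[0] = f i x by rewrite -(pP i).1 scale0r addr0.
pose q i := sg i *: p i.
have qE i t : (q i).[t] = g i (x + t *: delta_mx 0 j).
  by rewrite hornerZ -(pP i).1.
pose Pq := \prod_i q i ^+ k i.
have PqE t : Pq.[t] = P (x + t *: delta_mx 0 j).
  by rewrite horner_prod; apply: eq_bigr => i _; rewrite horner_exp qE.
pose Q : {poly R} := (- gauss c x)%:P - (x 0 j + c j) *: 'X - 2^-1 *: 'X^2.
have QE t : Q.[t] = - gauss c (x + t *: delta_mx 0 j).
  by rewrite gauss_line !(hornerD, hornerN, hornerZ, hornerC, hornerX, hornerXn); ring.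
pose h t := Pq.[t] * expR Q.[t].
have dh (t : R) : is_derive t 1 h
    (Pq^`().[t] * expR Q.[t] + Pq.[t] * (Q^`().[t] * expR Q.[t])).
  have d1 : is_derive t 1 (horner Pq) Pq^`().[t] by apply: is_derive_poly.
  have d2 : is_derive t 1 (horner Q) Q^`().[t] by apply: is_derive_poly.
  have d3 : is_derive t 1 (expR \o horner Q) (Q^`().[t] * expR Q.[t]).
    rewrite mulrC; exact: (is_derive1_comp (is_derive_expR _) d2).
  have d4 := is_deriveM d1 d3.
  by apply: (is_derive_eq d4); rewrite /= /GRing.scale/=; ring.
(* The region is open along the line through [x], so [h] has a local maximum at 0. *)
have [e e0 he] : exists2 e : R, 0 < e & forall t, `|t| < e -> forall i, 0 < (q i).[t].
  have : \forall t \near (0 : R), forall i, 0 < (q i).[t].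
    apply: (@filter_forall _ _ (fun i t => 0 < (q i).[t]) (nbhs (0 : R))) => i.
    have q0 : 0 < (q i).[0] by rewrite qE scale0r addr0.
    exact: (cvgr_gt _ (@continuous_horner _ (q i) 0) _ q0).
  move=> /nbhs_ballP[e e0 he]; exists e => // t te; apply: he.
  by rewrite /ball/= sub0r normrN.
have hmax : is_derive (0 : R) 1 h 0.
  apply: (@derive1_at_max _ h (- e) e 0).
  - by rewrite ge0_cp// ltW.
  - by move=> t _; have [] := dh t.
  - by rewrite in_itv/= oppr_lt0 e0.
  - move=> t; rewrite in_itv/= -ltr_norml => te.
    rewrite /h !PqE !QE scale0r addr0; apply: xmax => i.
    by rewrite -qE; apply: he.
(* The derivative of [h] at 0, computed by the product rule, must vanish. Cancelling the positive
   factors [expR] and [P x] leaves the logarithmic derivative: the sum of the [u_i d_j f_i] equals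
   [x_j + c_j]. *)
have := @derive_val _ _ _ _ _ _ _ (dh 0); rewrite (@derive_val _ _ _ _ _ _ _ hmax).
move/esym; rewrite /Pq deriv_prod_exp; last first.
  by move=> i; rewrite hornerZ p0E mulf_neq0// signr_eq0.
rewrite -/Pq mulrA -mulrDl => /eqP; rewrite mulf_eq0 (gt_eqF (expR_gt0 _)) orbF.
rewrite -mulrDr mulf_eq0 PqE scale0r addr0.
have Px0 : 0 < P x by apply: prodr_gt0 => i _; rewrite exprn_gt0.
rewrite (gt_eqF Px0)/=.
rewrite /Q !(derivD, derivN, derivC, derivZ, derivX, derivXn).
rewrite !(hornerD, hornerN, hornerZ, hornerC, hornerX, hornerXn, hornerMn).
rewrite (eq_bigr (fun i => (\row_i ((k i)%:R / f i x)) 0 i * df i j x)); last first.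
  move=> i _; rewrite derivZ !hornerZ p0E (pP i).2 mxE.
  by field; rewrite fx0 signr_eq0.
move/eqP; lra.
Qed.

(** For every [(c, k)] each realized pattern supplies a solution of the critical point system.
    Solutions from different patterns differ because a point realizes only one pattern, so every
    fiber has at least [#|T|] points. *)
Lemma card_sign_patterns (T : {set {ffun 'I_m -> bool}}) :
  (forall s, s \in T -> exists x, realizes s x) ->
  (#|T| * (n ^ n * m ^ m) <= D ^ n * (n + m) ^ (n + m))%N.
Proof.
move=> TP.
have /choice[df0 df0P] : forall ij : 'I_m * 'I_n, exists G, @bipoly R n m D 0 G /\
    forall x u, exists2 p : {poly R},
      forall t, f ij.1 (x + t *: delta_mx 0 ij.2) = p.[t] & p^`().[0] = G x u.
  by move=> ij; have [G ? ?] := bipoly_partial ij.2 (fP ij.1 m); exists G.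
pose df i j x := df0 (i, j) x 0.
(* The witness may formally depend on [u], but the restriction of [f i] to a line determines its
   derivative. *)
have df0E i j x u : df0 (i, j) x u = df i j x.
  have [p pf <-] := (df0P (i, j)).2 x u; have [q qf] := (df0P (i, j)).2 x 0.
  rewrite -/(df i j x) => <-; suff -> : p = q by [].
  apply/eqP; rewrite -subr_eq0; apply/eqP/poly0_of_nat_roots => B.
  by exists B => //; rewrite /root hornerD hornerN -pf -qf subrr.
pose G1 j (x : 'rV[R]_n) (u : 'rV[R]_m) := \sum_i u 0 i * df i j x - x 0 j.
pose G2 i (x : 'rV[R]_n) (u : 'rV[R]_m) := u 0 i * f i x.
apply: (@fiber_count_limit R) => k.
have -> : #|T| = #|{: {s | s \in T}}| by rewrite card_sig; apply: eq_card.
apply: (@fiber_count _ _ _ _ _ G1 G2) => [j|i|c k' k'0].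
- apply: bipolyD.
    apply: bipoly_sum => i _.
    apply: eq_bipoly (bipolyM (@bipoly_u R n m i) (df0P (i, j)).1) => x u.
    by rewrite df0E.
  apply: eq_bipoly (bipolyZ (- 1) (bipoly_leq D0 _ (@bipoly_x R n m j))) => // x u.
  by rewrite mulN1r.
- exact: bipoly_leq (bipolyM (@bipoly_u R n m i) (fP i m)).
have /choice[x /choice[u xuP]] : forall s : {s | s \in T}, exists x u,
    [/\ realizes (val s) x, forall j, G1 j x u = c j &
        forall i, G2 i x u = (k' i)%:R].
  move=> [s sT]; apply: critical_point (TP s sT) => // i j x.
  by have [p] := (df0P (i, j)).2 x 0; exists p.
exists x, u; split=> [s s' xss'|s]; last by have [_ ? ?] := xuP s.
have [r _ _] := xuP s; have [r' _ _] := xuP s'.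
apply/val_inj/ffunP => i; have [_ <-] := r i; have [_ <-] := r' i.
by rewrite xss'.
Qed.

End SignPatterns.

(** * Counting patterns *)

Lemma positive_lower_bound (R : realType) (I : finType) (v : I -> R) :
  exists2 e, 0 < e & forall i, 0 < v i -> e < v i.
Proof.
(* Halving makes the bound strict; 1 stands in for the values that are not positive. *)
exists (\big[Num.min/1]_i (if 0 < v i then v i / 2 else 1)).
  by apply: lt_bigmin => // i _; case: ifP => // v0; rewrite divr_gt0.
move=> i v0; apply: (@le_lt_trans _ _ (v i / 2)); last first.
  by rewrite ltr_pdivrMr// ltr_pMr// ltr1n.
by apply: (@bigmin_inf _ _ _ _ i) => //; rewrite v0.
Qed.

Lemma polyfun_sub_cst (R : realType) n D (f : 'rV[R]_n -> R) c :
  polyfun D f -> polyfun D (fun x => f x - c).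
Proof. by move=> fP m; apply: bipolyD; [exact: fP|exact: bipolyC]. Qed.

Section SignPatternBound.
Variables (R : realType) (n D : nat) (I : finType) (f : I -> 'rV[R]_n -> R).
Hypothesis D0 : (0 < D)%N.
Hypothesis fP : forall i, polyfun D (f i).

(* Lowering every [f i] by a small constant turns the patterns of [0 < f i]
   into strict sign patterns. *)
Lemma card_positivity_patterns (T : {set {ffun I -> bool}}) :
  (forall s, s \in T -> exists x, forall i, (0 < f i x) = s i) ->
  (#|T| * (n ^ n * #|I| ^ #|I|) <= D ^ n * (n + #|I|) ^ (n + #|I|))%N.
Proof.
move=> TP.
have /choice[x xP] : forall s, exists x, s \in T -> forall i, (0 < f i x) = s i.
  move=> s; have [/TP[x xs]|_] := boolP (s \in T); first by exists x.
  by exists 0.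
have [e e0 eP] := positive_lower_bound (fun si => f si.2 (x si.1)).
pose enc (s : {ffun I -> bool}) := [ffun k : 'I_#|I| => s (enum_val k)].
have enc_inj : injective enc.
  move=> s s' /ffunP ss'; apply/ffunP => i.
  by have := ss' (enum_rank i); rewrite !ffunE enum_rankK.
rewrite -(card_imset T enc_inj).
apply: (@card_sign_patterns R n #|I| D (fun k y => f (enum_val k) y - e)) => //.
  by move=> k; apply: polyfun_sub_cst.
move=> _ /imsetP[s sT ->]; exists (x s) => k; rewrite ffunE -(xP s sT).
have := eP (s, enum_val k) => /=.
case: ltP => [f0 /(_ isT) ef|f0 _].
  by rewrite subr_gt0 ef subr_eq0 gt_eqF.
split; first by rewrite subr_eq0 lt_eqF// (le_lt_trans f0).
by apply/negbTE; rewrite -leNgt subr_le0 (le_trans f0)// ltW.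
Qed.

(** With [m] functions, split [(n + m) ^ (n + m)]: the power [m] is at most [m ^ m] times [e ^ n],
    and the power [n] is at most [(2 m) ^ n] since [n <= m]. *)
Lemma card_positivity_patterns_le (T : {set {ffun I -> bool}}) :
  (0 < n)%N -> (n <= #|I|)%N ->
  (forall s, s \in T -> exists x, forall i, (0 < f i x) = s i) ->
  #|T|%:R <= (2 * expR 1 * (D * #|I|)%:R / n%:R) ^+ n :> R.
Proof.
move=> n0 nI /card_positivity_patterns; set m := #|I|; set N := #|T| => NP.
have n0' : 0 < n%:R :> R by rewrite ltr0n.
have m0 : 0 < m%:R :> R by rewrite ltr0n (leq_trans n0).
have mm : 0 < (m%:R : R) ^+ m by rewrite exprn_gt0.
have le1 : (n + m)%:R ^+ m <= m%:R ^+ m * expR 1 ^+ n :> R.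
  rewrite -expRM_natl mulr1 (_ : expR n%:R = expR (n%:R / m%:R) ^+ m); last first.
    by rewrite -expRM_natl mulrC divfK ?gt_eqF.
  rewrite -exprMn lerXn2r ?nnegrE ?mulr_ge0 ?expR_ge0 ?ler0n//.
  rewrite -ler_pdivrMl// (le_trans _ (expR_ge1Dx _))//.
  by rewrite natrD mulrDr mulVf ?gt_eqF// addrC mulrC.
have le2 : (n + m)%:R ^+ n <= (2 * m%:R) ^+ n :> R.
  rewrite lerXn2r ?nnegrE ?mulr_ge0 ?ler0n// -natrM ler_nat mul2n -addnn.
  by rewrite leq_add2r.
rewrite expr_div_n ler_pdivlMr ?exprn_gt0// -(ler_pM2r mm).
have := NP; rewrite -(ler_nat R) !natrM !natrX exprD mulrA => /le_trans; apply.
rewrite [leRHS](_ : _ =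
    D%:R ^+ n * ((2 * m%:R) ^+ n * (m%:R ^+ m * expR 1 ^+ n))); last first.
  by rewrite !exprMn; ring.
by rewrite ler_wpM2l ?exprn_ge0 ?ler0n// ler_pM ?exprn_ge0 ?ler0n.
Qed.

End SignPatternBound.

(** * Two layers of parameters *)

Section PiecewisePolynomials.
Variable R : realType.
Implicit Types (v : R) (g : R -> R).

(** Only the interior knots are searched; when [v] exceeds them all, [find] returns [t.-1], the
    index of the last cell. *)
Definition cell_index (t : nat) v : nat :=
  find (fun h => v <= h.+1%:R / t%:R) (iota 0 t.-1).

Lemma cell_index_lt t v : (0 < t)%N -> (cell_index t v < t)%N.
Proof.
move=> t0; rewrite -[ltnRHS](prednK t0) ltnS -[leqRHS](size_iota 0).
exact: find_size.
Qed.

Lemma mem_cell_index t v : (0 < t)%N -> 0 <= v <= 1 ->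
  cell R t (cell_index t v) v.
Proof.
move=> t0 /andP[v0 v1]; have t0' : 0 < t%:R :> R by rewrite ltr0n.
set s := iota 0 t.-1; set a := fun h => v <= h.+1%:R / t%:R.
have vu : v <= (cell_index t v).+1%:R / t%:R.
  have [has_a|no_a] := boolP (has a s).
    have := nth_find 0 has_a; rewrite nth_iota ?add0n//.
    by rewrite -[ltnRHS](size_iota 0) -has_find.
  by rewrite /cell_index hasNfind// size_iota prednK// divff// gt_eqF.
case cE : (cell_index t v) vu => [|c] vu; rewrite /= in_itv/=.
  by rewrite v0 -[leRHS]mul1r.
rewrite vu andbT ltNge.
have := @before_find _ 0%N a s c; rewrite -[find _ _]/(cell_index t v) cE.
move=> /(_ (leqnn _)); rewrite nth_iota ?add0n /a; first by move=> ->.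
have := cell_index_lt v t0; rewrite cE -[ltnRHS](prednK t0) ltnS.
exact: leq_trans.
Qed.

(** The indicator selects the polynomial of cell [k], so the value is linear in the coefficients
    once [k] and [v] are fixed. *)
Definition piecewise_eval n r (c : 'I_n * 'I_r.+1 -> R) (k : nat) v :=
  \sum_(p : 'I_n * 'I_r.+1) (p.1 == k :> nat)%:R * (c p * v ^+ p.2).

Lemma piecewise_polyE n r g : (0 < n)%N ->
  piecewise_poly (regular_partition R n) r g ->
  exists c : 'I_n * 'I_r.+1 -> R, forall v, 0 <= v <= 1 ->
    g v = piecewise_eval c (cell_index n v) v.
Proof.
move=> n0 gP.
have /choice[p pP] : forall k : 'I_n, exists p : {poly R},
    (size p <= r.+1)%N /\ forall v, cell R n k v -> g v = p.[v].
  move=> k; have [|p] := gP (cell R n k); last by exists p.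
  by exists (k : nat) => //=; apply: ltn_ord.
exists (fun kl : 'I_n * 'I_r.+1 => (p kl.1)`_kl.2) => v v01.
pose k := Ordinal (cell_index_lt v n0).
rewrite (pP k).2; last exact: mem_cell_index.
rewrite /piecewise_eval -(pair_bigA _ (fun (k' : 'I_n) (l : 'I_r.+1) =>
  (k' == k :> nat)%:R * ((p k')`_l * v ^+ l)))/=.
rewrite (bigD1 k)//= [X in _ + X]big1 ?addr0; last first.
  move=> k' kk'; apply: big1 => l _.
  by rewrite (_ : _ == _ :> nat = false) ?mul0r//; apply: negbTE.
rewrite (horner_coef_wide _ (pP k).1); apply: eq_bigr => l _.
by rewrite eqxx mul1r.
Qed.

End PiecewisePolynomials.

Section PolyfunOperations.
Variable R : realType.

Lemma bipoly_lsubmx n1 n2 m A B F : @bipoly R n1 m A B F ->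
  @bipoly R (n1 + n2) m A B (fun x u => F (lsubmx x) u).
Proof.
elim=> {A B F}.
- by move=> c; constructor.
- move=> j; apply: eq_bipoly (@bipoly_x R (n1 + n2) m (lshift n2 j)) => x u.
  by rewrite mxE.
- by move=> i; constructor.
- by move=> A B F G _ ? _ ?; apply: bipolyD.
- by move=> A B A' B' F G _ ? _ ?; apply: bipolyM.
- by move=> A B A' B' F AA' BB' _; apply: bipoly_leq.
Qed.

(** Each term is one parameter times a power of [v] of exponent at most [r], of degree at most
    [1 + D * r]. The inner layer takes [D = 0], the outer layer [D = 1]. *)
Lemma polyfun_piecewise_eval n n' r D E (c : 'I_n' * 'I_r.+1 -> 'I_n) k
    (v : 'rV[R]_n -> R) : (D * r < E)%N -> polyfun D v ->
  polyfun E (fun x => piecewise_eval (fun p => x 0 (c p)) k (v x)).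
Proof.
move=> DrE vP m; apply: bipoly_sum => p _; apply: bipolyZ.
apply: bipoly_leq (bipolyM (@bipoly_x R n m (c p)) (bipolyX p.2 (vP m))) => //.
by apply: leq_ltn_trans DrE; rewrite leq_mul2l -ltnS ltn_ord orbT.
Qed.

End PolyfunOperations.

Section TwoLayerCount.
Variables (R : realType) (m n1 t r : nat) (L : 'I_m -> 'rV[R]_n1 -> R).
Variables (vm vp : R) (y : 'I_m -> R).
Local Notation pattern := {ffun 'I_m -> bool}.
Local Notation outer := ('I_t * 'I_r.+1)%type.
Variables (a : pattern -> 'rV[R]_n1) (b : pattern -> outer -> R).
Hypothesis LP : forall i, polyfun 1 (L i).
Hypothesis t0 : (0 < t)%N.
Hypothesis n10 : (0 < n1)%N.
Hypothesis mge : (n1 + #|{: outer}| <= m)%N.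
Let inner i s : R := clamp 0 1 (L i (a s)).
Hypothesis shatter : forall s i,
  (y i < clamp vm vp (piecewise_eval (b s) (cell_index t (inner i s)) (inner i s)))
  = s i.

Local Notation threshold := ('I_m * 'I_t.+1)%type.

(** The knots run from 0 to [t] inclusive: the extreme ones decide the clamping, the others the
    cell. *)
Let thr (ih : threshold) (x : 'rV[R]_n1) : R := L ih.1 x - ih.2%:R / t%:R.

Let tau (s : pattern) : {ffun threshold -> bool} := [ffun ih => 0 < thr ih (a s)].

Lemma card_tau : #|(tau @: finset predT)%SET|%:R <=
  (2 * expR 1 * (m * t.+1)%:R / n1%:R) ^+ n1 :> R.
Proof.
have -> : (m * t.+1)%N = (1 * #|{: threshold}|)%N.
  by rewrite card_prod !card_ord mul1n.
apply: (@card_positivity_patterns_le _ _ _ _ thr) => //.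
- by move=> ih; apply: polyfun_sub_cst.
- rewrite card_prod !card_ord.
  by apply: leq_trans (leq_pmulr _ _) => //; apply: leq_trans mge; apply: leq_addr.
- by move=> _ /imsetP[s _ ->]; exists (a s) => ih; rewrite ffunE.
Qed.

Section Fiber.
Variable T : {ffun threshold -> bool}.

(* Whether the clamped inner value is 0, 1 or L i, and the cell it lies in,
   depend on T alone. *)
Let inner_fiber i (x : 'rV[R]_n1) : R :=
  if ~~ T (i, ord0) then 0 else if T (i, ord_max) then 1 else L i x.

Let cell_fiber i := find (fun h => ~~ T (i, inord h.+1)) (iota 0 t.-1).

Lemma inner_fiberE s i : tau s = T ->
  inner i s = inner_fiber i (a s) /\ cell_index t (inner i s) = cell_fiber i.
Proof.
move=> sT; have t0' : 0 < t%:R :> R by rewrite ltr0n.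
have TE h : T (i, h) = (h%:R / t%:R < L i (a s)).
  by rewrite -sT ffunE /thr subr_gt0.
split.
  rewrite /inner_fiber !TE /= mul0r divff ?gt_eqF// /inner /clamp.
  rewrite -leNgt maxEle; case: ifP => _; first by rewrite min_l.
  by rewrite minEle ltNge; case: (_ <= 1).
rewrite /cell_index /cell_fiber; apply: eq_in_find => h.
rewrite mem_iota add0n => /= ht.
have ht' : (h.+1 < t)%N by rewrite -[ltnRHS](prednK t0) ltnS.
rewrite TE inordK; last exact: leqW.
(* An interior knot lies in [[0, 1[], so clamping does not change the comparison with it. *)
rewrite -leNgt /inner /clamp ge_min ge_max.
have -> : 0 <= h.+1%:R / t%:R :> R by rewrite divr_ge0.
rewrite [X in _ || X](_ : _ = false) ?orbF ?andbT//.
by apply/negbTE; rewrite -ltNge ltr_pdivrMr// mul1r ltr_nat.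
Qed.

Let param (s : pattern) : 'rV[R]_(n1 + #|{: outer}|) :=
  row_mx (a s) (\row_k b s (enum_val k)).

Let pre (i : 'I_m) (x : 'rV[R]_(n1 + #|{: outer}|)) : R :=
  piecewise_eval (fun p => x 0 (rshift n1 (enum_rank p))) (cell_fiber i)
    (inner_fiber i (lsubmx x)) - y i.

Lemma pre_polyfun i : polyfun r.+1 (pre i).
Proof.
apply: polyfun_sub_cst; apply: (@polyfun_piecewise_eval _ _ _ _ 1) => [|p].
  by rewrite mul1n.
rewrite /inner_fiber.
case: (T (i, ord0)) => /=; last exact: bipolyC.
case: (T (i, ord_max)); first exact: bipolyC.
exact: bipoly_lsubmx (LP i p).
Qed.

(** A level below [clamp vm vp z] is below [vp], and below [vm] or [z]. On a fiber of [tau] the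
    pattern is thus read off from the signs of the polynomials [pre i]. *)
Lemma preE s i : tau s = T ->
  s i = (y i < vp) && ((y i < vm) || (0 < pre i (param s))).
Proof.
move=> sT; rewrite -[LHS]shatter; have [-> ->] := inner_fiberE i sT.
rewrite /clamp lt_min lt_max andbC orbC /pre subr_gt0.
congr (_ && (_ || (_ < _))); rewrite /param row_mxKl.
apply: eq_bigr => p _.
by rewrite row_mxEr mxE enum_rankK.
Qed.

(** By [preE] the map [rho] to positivity patterns is injective on the fiber, so the count for
    degree [r.+1] in the joint parameters applies. *)
Lemma card_tau_fiber : #|finset (fun s => tau s == T)|%:R <=
  (2 * expR 1 * (r.+1 * m)%:R / (n1 + #|{: outer}|)%:R) ^+ (n1 + #|{: outer}|) :> R.
Proof.
pose rho (s : pattern) : pattern := [ffun i => 0 < pre i (param s)].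
rewrite -(card_in_imset (f := rho)); last first.
  move=> s s'; rewrite !inE => /eqP sT /eqP sT' /ffunP rr; apply/ffunP => i.
  by rewrite (preE i sT) (preE i sT'); have := rr i; rewrite !ffunE => ->.
have -> : (r.+1 * m)%N = (r.+1 * #|'I_m|)%N by rewrite card_ord.
apply: (@card_positivity_patterns_le _ _ _ _ pre) => //.
- exact: pre_polyfun.
- by rewrite addn_gt0 n10.
- by rewrite card_ord.
- by move=> _ /imsetP[s _ ->]; exists (param s) => i; rewrite ffunE.
Qed.

End Fiber.

(** All [2 ^ m] patterns are partitioned by [tau]: the number of classes times the bound on each. *)
Lemma two_layer_count : 2 ^+ m <=
  (2 * expR 1 * (m * t.+1)%:R / n1%:R) ^+ n1 *
  (2 * expR 1 * (r.+1 * m)%:R / (n1 + #|{: outer}|)%:R) ^+ (n1 + #|{: outer}|) :> R.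
Proof.
have -> : 2 ^+ m = #|{: pattern}|%:R :> R.
  by rewrite card_ffun card_bool card_ord natrX.
rewrite -sum1_card (partition_big tau (mem (tau @: finset predT)%SET))/=; last first.
  by move=> s _; apply: imset_f; rewrite inE.
rewrite natr_sum; apply: (@le_trans _ _ (\sum_(T in (tau @: finset predT)%SET)
  (2 * expR 1 * (r.+1 * m)%:R / (n1 + #|{: outer}|)%:R) ^+ (n1 + #|{: outer}|))).
  apply: ler_sum => T _; apply: le_trans (card_tau_fiber T).
  by rewrite ler_nat sum1_card; apply: eq_leq; apply: eq_card => s; rewrite !inE.
by rewrite sumr_const -[leLHS]mulr_natl ler_wpM2r ?card_tau.
Qed.

End TwoLayerCount.

(** * From the count to the dimension *)

Section LogarithmicBound.
Variable R : realType.

Lemma ln_le_tangent (x y : R) : 0 < x -> 0 < y -> ln x <= ln y + x / y - 1.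
Proof.
move=> x0 y0; have := @le_ln1Dx R (x / y - 1).
rewrite [1 + _]addrC subrK lnM ?posrE ?invr_gt0// lnV ?posrE// => H.
have := H; rewrite ltrBrDr addNr divr_gt0// => /(_ isT); lra.
Qed.

Lemma ln2_ge : 2^-1 <= ln 2 :> R.
Proof.
have := @ln_le_tangent 1 2 ltr01 (ltr0Sn _ _); rewrite ln1; lra.
Qed.

(** Put [Q = 2 * B * log2 B] and [x0 = log2 Q]. Since [Q <= B ^+ 2], one has [B * x0 <= Q], so the
    hypothesis inequality is already reversed at [x0]. The tangent to [ln] at [x0], with
    [x0 * ln 2 > 1], then excludes [z > x0]. *)
Lemma le_log2_self (B z : R) : 2 * expR 1 <= B -> 4 <= B -> 0 < z ->
  z * ln 2 <= ln (B * z) -> z <= log2 (2 * B * log2 B).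
Proof.
move=> eB B4 z0; rewrite /log2; set l := ln 2 => zB.
have l2 : 2^-1 <= l by apply: ln2_ge.
have l0 : 0 < l by apply: lt_le_trans l2; rewrite invr_gt0.
have B0 : 0 < B by apply: lt_le_trans B4.
(* The tangent to [ln] at 4; this is where [4 <= B] enters, and it yields [Q <= B ^+ 2]. *)
have lnB4 : ln B <= B * l / 2.
  have := ln_le_tangent B0 (ltr0Sn R 3).
  have -> : ln 4 = 2 * l :> R.
    by rewrite (_ : 4 = 2 * 2)// ?lnM ?posrE// -/l; [ring|rewrite -natrM].
  nra.
have lnB1 : 1 < ln B.
  rewrite -[ltLHS]expRK ltr_ln ?posrE ?expR_gt0//.
  apply: lt_le_trans eB; have := expR_gt0 (1 : R); lra.
set Q := 2 * B * (ln B / l).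
have l1 : l <= 1.
  have := @ln_le_tangent 2 1 (ltr0Sn _ _) ltr01; rewrite ln1 -/l; lra.
have BQ : B <= Q.
  rewrite /Q mulrAC -[leLHS]mul1r ler_wpM2r ?(ltW B0)//.
  rewrite mulrA ler_pdivlMr//; lra.
have lnQ1 : 1 < ln Q.
  by apply: lt_le_trans lnB1 _; rewrite ler_ln// posrE// (lt_le_trans B0).
have Q0 : 0 < Q by apply: lt_le_trans BQ.
have QB : Q <= B ^+ 2.
  rewrite /Q expr2 [2 * B]mulrC -mulrA ler_pM2l// mulrA ler_pdivrMr//; lra.
set x0 := ln Q / l.
have li0 : 0 < l^-1 by rewrite invr_gt0.
have lnB0 : 0 < ln B by apply: lt_trans lnB1.
have lnQ0 : 0 < ln Q by apply: lt_trans lnQ1.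
have x00 : 0 < x0 by rewrite divr_gt0.
have x0l : x0 * l = ln Q by rewrite divfK ?gt_eqF.
have key : ln B + ln x0 <= x0 * l.
  rewrite x0l -lnM ?posrE// ler_ln ?posrE ?mulr_gt0// /Q.
  rewrite [2 * B]mulrC -mulrA ler_pM2l// mulrA /x0 ler_pM2r//.
  by have := QB; rewrite -ler_ln ?posrE ?exprn_gt0// lnXn// mulr_natl.
clearbody x0 Q l; have := ln_le_tangent z0 x00.
rewrite lnM ?posrE// in zB => tz.
have x0l1 : 1 < x0 * l by rewrite x0l.
have : z * x0 * l <= x0 * x0 * l + z - x0.
  have : z * l <= x0 * l + z / x0 - 1 by lra.
  rewrite -(ler_pM2l x00) mulrBr mulrDr [x0 * (z / x0)]mulrC divfK ?gt_eqF// mulr1.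
  lra.
nra.
Qed.

Lemma log2_ge1 (x : R) : 2 <= x -> 1 <= log2 x.
Proof.
move=> x2; rewrite /log2 ler_pdivlMr ?ln_gt0 ?ltr1n// mul1r ler_ln ?posrE//.
by apply: lt_le_trans x2.
Qed.

(** Jensen for [ln], through its tangent at [Y], an upper bound for the weighted mean of [X1] and
    [X2]. *)
Lemma entropy_bound (n1 n2 : nat) (X1 X2 Y : R) :
  0 < X1 -> 0 < X2 -> 0 < Y -> n1%:R * X1 + n2%:R * X2 <= (n1 + n2)%:R * Y ->
  ln (X1 ^+ n1 * X2 ^+ n2) <= (n1 + n2)%:R * ln Y.
Proof.
move=> X10 X20 Y0 H; rewrite lnM ?posrE ?exprn_gt0// !lnXn//.
rewrite -[X in X + _]mulr_natl -[X in _ + X]mulr_natl.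
have := ler_wpM2l (ler0n R n1) (ln_le_tangent X10 Y0).
have := ler_wpM2l (ler0n R n2) (ln_le_tangent X20 Y0).
have : n1%:R * (X1 / Y) + n2%:R * (X2 / Y) <= (n1 + n2)%:R.
  by rewrite !mulrA -mulrDl ler_pdivrMr.
rewrite natrD; lra.
Qed.

(** With [W = n1 + (n1 + n2)], the mean of the two bases weighted by their exponents is
    [2 e U m / W]: this is where [U = (t + 1) + (r + 1)] arises. Then [le_log2_self] applies to
    [z = m / W]. *)
Lemma sample_size_bound (n1 n2 m t r : nat) : (0 < n1)%N ->
  (n1 + n2 <= m)%N ->
  let U : R := (t + r + 2)%:R in let e : R := expR 1 in (0 < t)%N ->
  2 ^+ m <= (2 * e * (m * t.+1)%:R / n1%:R) ^+ n1 *
    (2 * e * (r.+1 * m)%:R / (n1 + n2)%:R) ^+ (n1 + n2) ->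
  m%:R <= (n1 + (n1 + n2))%:R * log2 (4 * e * U * log2 (2 * e * U)).
Proof.
move=> n10 nm U e t0 H; have e2 : 2 <= e by have := expR_ge1Dx (1 : R).
have e0 : 0 < e by apply: expR_gt0.
have U3 : 3 <= U by rewrite ler_nat; lia.
set B := 2 * e * U; have -> : 4 * e * U = 2 * B by rewrite /B; ring.
have W0 : 0 < (n1 + (n1 + n2))%:R :> R by rewrite ltr0n addn_gt0 n10.
have n10' : 0 < n1%:R :> R by rewrite ltr0n.
have n20' : 0 < (n1 + n2)%:R :> R by rewrite ltr0n addn_gt0 n10.
have mN : (0 < m)%N by rewrite (leq_trans _ nm)// addn_gt0 n10.
have m0 : 0 < m%:R :> R by rewrite ltr0n.
have eU : 3 * e <= e * U by rewrite mulrC ler_wpM2l// ltW.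
have BE : B = 2 * (e * U) by rewrite /B mulrA.
have B4 : 4 <= B by rewrite BE; move: eU e2; clear; move: (e * U) => x; clearbody e; lra.
rewrite mulrC -ler_pdivrMr//; apply: le_log2_self => //.
- by rewrite BE -/e; move: eU e2; clear; move: (e * U) => x; clearbody e; lra.
- by rewrite divr_gt0.
set X1 := _ / n1%:R in H; set X2 := _ / (n1 + n2)%:R in H.
have X10 : 0 < X1 by rewrite divr_gt0// !mulr_gt0// ltr0n muln_gt0 mN.
have X20 : 0 < X2 by rewrite divr_gt0// !mulr_gt0// ltr0n muln_gt0 mN.
rewrite mulrAC ler_pdivrMr// [leRHS]mulrC.
apply: le_trans (entropy_bound X10 X20 _ _).
- by rewrite mulr_natl -lnXn// ler_ln// posrE ?exprn_gt0// mulr_gt0// exprn_gt0.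
- by rewrite mulr_gt0 ?divr_gt0// (lt_le_trans _ B4).
rewrite /X1 /X2 mulrC divfK ?gt_eqF// [X in _ + X]mulrC divfK ?gt_eqF//.
rewrite [leRHS]mulrC mulrA divfK ?gt_eqF// /B /U !natrM !natrD -!natr1.
by rewrite le_eqVlt; apply/orP; left; apply/eqP; ring.
Qed.

End LogarithmicBound.

(** * The additive class as a two-layer parametric family *)

Section AdditiveClass.
Variables (R : realType) (vm vp : R) (d r t : nat) (N : 'I_d -> nat).
Variable (pi : 'I_d -> set (set R)).
Hypothesis N0 : forall j, (0 < N j)%N.
Hypothesis piE : forall j, pi j = regular_partition R (N j).
Hypothesis t0 : (0 < t)%N.

Local Notation coef := {j : 'I_d & ('I_(N j) * 'I_r.+1)%type}.
Local Notation outer := ('I_t * 'I_r.+1)%type.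

(** One vector [x] stores the coefficients of all components; [coef] is a dependent sum because the
    partitions may differ in size. *)
Definition additive_eval (w : 'rV[R]_d) (x : 'rV[R]_#|{: coef}|) : R :=
  \sum_j piecewise_eval
    (fun p : 'I_(N j) * 'I_r.+1 => x 0 (enum_rank (existT _ j p : coef)))
    (cell_index (N j) (w 0 j)) (w 0 j).

Lemma card_coef : #|{: coef}| = (\sum_j N j * r.+1)%N.
Proof.
rewrite card_tagged sumnE big_map big_enum.
by apply: eq_bigr => j _; rewrite card_prod !card_ord.
Qed.

Lemma additive_eval_polyfun w : polyfun 1 (additive_eval w).
Proof.
move=> m; apply: bipoly_sum => j _.
apply: (@polyfun_piecewise_eval R _ (N j) r 0 1 _ _ (fun=> w 0 j)) => // k.
exact: bipolyC.
Qed.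

(** Clamping places [v] in [[0, 1]], where [piecewise_polyE] represents the outer function; on the
    cube it likewise represents each [g j]. *)
Lemma additive_classE h : additive_class vm vp pi t r h ->
  exists (x : 'rV[R]_#|{: coef}|) (b : outer -> R), forall w, unit_cube R d w ->
    let v := clamp 0 1 (additive_eval w x) in
    h w = clamp vm vp (piecewise_eval b (cell_index t v) v).
Proof.
move=> [f [g [[q qP fq] gP hE]]].
have [b bP] := piecewise_polyE t0 qP.
have cex j : exists c : 'I_(N j) * 'I_r.+1 -> R,
    forall v, 0 <= v <= 1 -> g j v = piecewise_eval c (cell_index (N j) v) v.
  by have := gP j; rewrite piE => /(piecewise_polyE (N0 j)).
pose c j := sval (cid (cex j)); have cP j := svalP (cid (cex j)).
pose x : 'rV[R]_#|{: coef}| := \row_k c (tag (enum_val k)) (tagged (enum_val k)).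
exists x, b => w wc v.
have v01 : 0 <= v <= 1.
  by rewrite /v /clamp le_min ge_min lexx orbT le_max lexx ler01 orbT.
rewrite hE// (_ : \sum_j g j (w 0 j) = additive_eval w x); last first.
  apply: eq_bigr => j _; rewrite cP; last by have := wc j; rewrite /= in_itv.
  by apply: eq_bigr => p _; rewrite mxE enum_rankK.
by rewrite fq ?bP//= in_itv.
Qed.

Lemma shattered_size (w : nat -> 'rV[R]_d * R) (m : nat) :
  (forall i, (i < m)%N -> unit_cube R d (w i).1) ->
  (forall s : {ffun 'I_m -> bool}, exists2 h, additive_class vm vp pi t r h &
     forall i : 'I_m, ((w i).2 < h (w i).1) = s i) ->
  (0 < d)%N ->
  m%:R <= (t%:R * (r.+1)%:R + 2 * \sum_(j < d) (N j)%:R * (r.+1)%:R)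
    * log2 (4 * expR 1 * (t + r + 2)%:R * log2 (2 * expR 1 * (t + r + 2)%:R)) :> R.
Proof.
move=> wc shatter d0.
pose n1 := #|{: coef}|; pose n2 := #|{: outer}|.
have n10 : (0 < n1)%N.
  by rewrite /n1 card_coef (bigD1 (Ordinal d0))//= addn_gt0 muln_gt0 N0.
(* The inner parameters enter both counts, hence the factor 2. *)
have -> : t%:R * (r.+1)%:R + 2 * \sum_(j < d) (N j)%:R * (r.+1)%:R =
    (n1 + (n1 + n2))%:R :> R.
  rewrite /n2 card_prod !card_ord /n1 card_coef !natrD natrM natr_sum.
  by under [in RHS]eq_bigr do rewrite natrM; ring.
(* The counts require at least as many sample points as parameters; smaller samples satisfy the
   bound because the [log2] factor is at least 1. *)
have [nm|mn] := leqP (n1 + n2) m; last first.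
  apply: (@le_trans _ _ (n1 + (n1 + n2))%:R).
    by rewrite ler_nat ltnW// (leq_trans mn)// leq_addl.
  rewrite ler_peMr ?ler0n//; set U : R := (t + r + 2)%:R.
  have e2 : 2 <= expR 1 :> R by have := expR_ge1Dx (1 : R).
  have eU : 2 <= expR 1 * U.
    by rewrite -[leLHS]mulr1 ler_pM// ler1n addn2.
  have log1 : 1 <= log2 (2 * expR 1 * U) by apply: log2_ge1; rewrite -mulrA; lra.
  apply: log2_ge1; rewrite -[leLHS]mulr1 ler_pM// -mulrA; lra.
have /choice[h hP] : forall s : {ffun 'I_m -> bool}, exists h,
    additive_class vm vp pi t r h /\ forall i : 'I_m, ((w i).2 < h (w i).1) = s i.
  by move=> s; have [h] := shatter s; exists h.
have /choice[a /choice[b ab]] := fun s => additive_classE (hP s).1.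
apply: sample_size_bound => //.
apply: (@two_layer_count _ _ _ _ _ (fun i => additive_eval (w i).1) vm vp
  (fun i => (w i).2) a b) => // [i|s i]; first exact: additive_eval_polyfun.
by rewrite -(ab s (w i).1) ?(hP s).2//; apply: wc.
Qed.

End AdditiveClass.

(** Cells are distinct sets because the right endpoint of cell [k] lies in no other cell. *)
Lemma ncells_regular_partition (R : realType) n : (0 < n)%N ->
  ncells (regular_partition R n) = n.
Proof.
move=> n0; have n0' : 0 < n%:R :> R by rewrite ltr0n.
have endpoint k : cell R n k (k.+1%:R / n%:R).
  case: k => [|k] /=; rewrite in_itv/= ?mul1r ?lexx ?andbT ?invr_ge0 ?ler0n//.
  by rewrite ltr_pM2r ?invr_gt0// ltr_nat.
have endpoint_inj k k' : cell R n k (k'.+1%:R / n%:R) -> k = k'.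
  case: k => [|k] /=; rewrite in_itv/= => /andP[].
    by move=> _; rewrite -[leRHS]mul1r ler_pM2r ?invr_gt0// lern1; case: k'.
  rewrite ltr_pM2r ?ler_pM2r ?invr_gt0// ltr_nat ler_nat; lia.
apply: card_fset_set; apply: inj_card_eq => k k' _ _ kk'.
by apply: endpoint_inj; rewrite kk'; apply: endpoint.
Qed.

Lemma shattered_patterns (T : pointedType) (R : realType) (F : set (T -> R))
    (S : set (T * R)) n : (S #= `I_n)%card -> shattered F S ->
  exists2 w : nat -> T * R, forall i, (i < n)%N -> S (w i) &
    forall s : {ffun 'I_n -> bool}, exists2 f, F f &
      forall i : 'I_n, ((w i).2 < f (w i).1) = s i.
Proof.
rewrite card_eq_sym => /card_set_bijP[w [wS wI _]] FS.
exists w => [i|s]; first exact: wS.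
have [|f Ff AE] := FS [set w i | i in [set i : 'I_n | s i]].
  by move=> _ [i _ <-]; apply: wS; apply: ltn_ord.
exists f => // i; apply/idP/idP => [fi|si].
  have [i' si' wi'] : [set w i | i in [set i : 'I_n | s i]] (w i).
    by rewrite AE; split => //; apply: wS; apply: ltn_ord.
  suff -> : i = i' by [].
  by apply: val_inj; apply: wI; rewrite ?inE ?wi'//=; apply: ltn_ord.
have : [set w i | i in [set i : 'I_n | s i]] (w i) by exists i.
by rewrite AE => -[].
Qed.

Theorem proposition1 (R : realType) (vm vp : R) (hv : vm < vp)
    (d r t : nat) (hd : (0 < d)%N) (ht : (0 < t)%N)
    (pi : 'I_d -> set (set R)) (hpi : forall j, dyadic_partitions R (pi j)) :
  let U : R := (t + r + 2)%:R in
  let e : R := expR 1 in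
  exists2 V : nat,
    vc_subgraph_dim (unit_cube R d) (additive_class vm vp pi t r) V &
    V%:R <= 2 + (t%:R * (r.+1)%:R
                 + 2 * \sum_(j < d) (ncells (pi j))%:R * (r.+1)%:R)
              * log2 (4 * e * U * log2 (2 * e * U)).
Proof.
move=> U e; set bound := 2 + _.
pose vc_set n (S : set ('rV[R]_d * R)) := [/\ S `<=` unit_cube R d `*` [set: R],
  (S #= `I_n)%card & shattered (additive_class vm vp pi t r) S].
have le_bound n S : vc_set n S -> n%:R <= bound.
  move=> [SW Sn /(shattered_patterns Sn)[w wS ws]].
  have /choice[s sP] : forall j, exists s, regular_partition R (2 ^ s) = pi j.
    by move=> j; have [s _ <-] := hpi j; exists s.
  have N0 j : (0 < 2 ^ s j)%N by rewrite expn_gt0.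
  have wW i : (i < n)%N -> unit_cube R d (w i).1 by move=> /wS/SW[].
  have := shattered_size N0 (fun j => esym (sP j)) ht wW ws hd.
  under eq_bigr do rewrite -(ncells_regular_partition R (N0 _)) sP.
  by move=> /le_trans; apply; rewrite /bound lerDr.
(* A member of the class makes the empty sample shattered, so the set of shattered sizes is
   nonempty; its boundedness then gives a maximum. *)
have [f0 f0P] : exists f, additive_class vm vp pi t r f.
  exists (fun=> clamp vm vp 0), (fun=> clamp vm vp 0), (fun _ _ => 0).
  split=> // [|j I _]; last by exists 0 => [|x _]; rewrite ?size_poly0 ?horner0.
  exists (fun=> 0) => // I _.
  by exists 0 => [|x _]; rewrite ?size_poly0 ?horner0.
pose P n := `[< exists S, vc_set n S >].
have P0 : exists n, P n.
  exists 0%N; apply/asboolP; exists set0; split=> //.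
    by rewrite II0.
  by move=> A; rewrite subset0 => ->; exists f0; rewrite // set0I.
have P_le n : P n -> (n <= Num.truncn bound)%N.
  move=> /asboolP[S /le_bound nb].
  by rewrite truncn_ge_nat// (le_trans _ nb).
case: (ex_maxnP P0 P_le) => V /asboolP[S SV] Vmax.
exists V; last exact: le_bound SV.
split=> [|S' n S'W S'n S'F]; first by exists S.
by apply: Vmax; apply/asboolP; exists S'.
Qed.
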